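(* Let $m \equiv 3 \pmod 4$ and $n \equiv 1 \pmod 4$ be two distinct square-free positive integers, and let $K = \mathbb{Q}(\sqrt{-m},\sqrt{n})$. Then $\mathfrak{S}_K = \mathcal{O}_K$, i.e. every element of $\mathcal{O}_K$ is a (finite) sum of squares of elements of $\mathcal{O}_K$.
   Context: For a number field $K$, $\mathcal{O}_K$ denotes its ring of integers, and $\mathfrak{S}_K$ denotes the set of all elements of $\mathcal{O}_K$ which are finite sums of squares of elements of $\mathcal{O}_K$. *)

(* Defs.v *)
From mathcomp Require Import all_boot all_order all_algebra all_field.
Set Implicit Arguments.
Unset Strict Implicit.
Unset Printing Implicit Defensive.
Import GRing.Theory.

Definition squarefree (n : nat) : Prop := forall d : nat, d ^ 2 %| n -> d = 1.

Local Open Scope ring_scope.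

(* A number field is a [fieldExtType rat], that is, a finite-dimensional field
   extension of the rationals. *)

Definition ring_of_integers (K : fieldExtType rat) (z : K) : Prop :=
  integralOver (intr : int -> K) z.

Definition sums_of_squares (K : fieldExtType rat) (z : K) : Prop :=
  ring_of_integers z /\
  exists s : seq K,
    (forall y : K, y \in s -> ring_of_integers y) /\ z = \sum_(y <- s) y ^+ 2.

(* [K] is Q(sqrt(-m), sqrt n): it is generated over the rationals by a square
   root [a] of -m and a square root [b] of n.  Nothing depends on which square
   roots are meant, since replacing [a] or [b] by its opposite does not change
   the generated field. *)
Definition is_adjunction_of_sqrts (m n : nat) (K : fieldExtType rat) : Prop :=
  exists a b : K,
    [/\ a ^+ 2 = - m%:R, b ^+ 2 = n%:R & <<1 & [:: a; b]>>%VS = fullv].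

(* Main.v *)
(* Since -m is a square in O_K and m - 1 is a sum of ones, -1 is a sum of squares;
   hence the sums of squares form a subring S, and 2x = (x + 1)^2 - x^2 - 1 puts
   2 O_K inside S.  If t = (1 + sqrt d)/2 with d = 4k + 1, then t = t^2 - k lies in S.
   Going up the tower Q < Q(sqrt -m) < K, in each step F < F(t) the ring d O_F(t) is
   contained in O_F + O_F t, so d z lies in S for z in O_F(t) as soon as O_F lies in S;
   as d is odd and 2z lies in S, so does z. *)
Require Import Defs.
From mathcomp Require Import all_boot all_order all_algebra all_field.
From mathcomp Require Import ring.

Section SumsOfSquares.

Set Implicit Arguments.
Unset Strict Implicit.

Import GRing.Theory.
Local Open Scope ring_scope.

Variable K : fieldExtType rat.
Implicit Types (a b x y z t u v : K) (F : {subfield K}) (k : int).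

Local Notation integer := (@ring_of_integers K).
Local Notation sqsum := (@sums_of_squares K).

Lemma integer_intr k : integer k%:~R.
Proof. exact: integral_id. Qed.

(** By Gauss's lemma, a monic integer polynomial vanishing at [c] has an integer factor proportional
    to ['X - c], whose leading coefficient must be a unit. *)
Lemma rational_integer (c : rat) : integer c%:A -> exists k, c%:A = k%:~R :> K.
Proof.
case=> p /monicP mon_p.
have -> : map_poly intr p = map_poly (in_alg K) (map_poly (intr : int -> rat) p).
  by rewrite -map_poly_comp; apply: eq_map_poly => i /=; rewrite scaler_int.
rewrite (fmorph_root (in_alg K)) -dvdp_XsubCl.
case/dvdpP_rat_int=> q [a _ Dq] [r Dp].
pose e := lead_coef r.
have qe1 : lead_coef q * e = 1 by rewrite -lead_coefM -Dp.
have aq1 : a * (lead_coef q)%:~R = 1.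
  have := congr1 lead_coef Dq.
  by rewrite lead_coefXsubC lead_coefZ lead_coef_map_inj //; apply: intr_inj.
(* Both [a] and [e] are inverse to the leading coefficient of [q], so the rational factor [a] is an
   integer. *)
have De : a = e%:~R.
  transitivity (a * (lead_coef q * e)%:~R); first by rewrite qe1 mulr1.
  by rewrite rmorphM mulrA aq1 mul1r.
exists (- (e * q`_0)).
have := congr1 (fun f : {poly rat} => f`_0) Dq.
rewrite coefB coefX coefC coefZ coef_map /= sub0r De => /(congr1 -%R).
by rewrite opprK => ->; rewrite -rmorphM -rmorphN /= scaler_int.
Qed.

Lemma sqsum_sqr x : integer x -> sqsum (x ^+ 2).
Proof.
move=> Ix; split; first by rewrite expr2; apply: integral_mul.
by exists [:: x]; rewrite big_seq1; split=> // y /[1!inE]/eqP->.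
Qed.

Lemma sqsum0 : sqsum 0.
Proof. by split; [apply: integral0 | exists [::]; rewrite big_nil]. Qed.

Lemma sqsum1 : sqsum 1.
Proof. by rewrite -(expr1n K 2); apply/sqsum_sqr/integral1. Qed.

Lemma sqsumD x y : sqsum x -> sqsum y -> sqsum (x + y).
Proof.
move=> [Ix [s [Is Dx]]] [Iy [r [Ir Dy]]]; split; first exact: integral_add.
exists (s ++ r); rewrite big_cat -Dx -Dy; split=> // w.
by rewrite mem_cat => /orP[/Is | /Ir].
Qed.

Lemma sqsumM x y : sqsum x -> sqsum y -> sqsum (x * y).
Proof.
move=> [_ [s [Is ->]]] [_ [r [Ir ->]]]; rewrite mulr_suml big_seq.
elim/big_ind: _ => [||a /Is Ia]; [exact: sqsum0 | exact: sqsumD |].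
rewrite mulr_sumr big_seq; elim/big_ind: _ => [||b /Ir Ib].
- exact: sqsum0.
- exact: sqsumD.
- by rewrite -exprMn; apply/sqsum_sqr/integral_mul.
Qed.

Lemma sqsum_nat i : sqsum i%:R.
Proof.
by elim: i => [|i IHi]; [exact: sqsum0 | rewrite -natr1; apply: (sqsumD IHi sqsum1)].
Qed.

Lemma sqsumN1_sqrtN (a : K) m : (0 < m)%N -> a ^+ 2 = - m%:R -> sqsum (- 1).
Proof.
move=> m_gt0 Da; have -> : -1 = a ^+ 2 + m.-1%:R.
  by rewrite Da -{1}(prednK m_gt0) -natr1; ring.
apply: sqsumD (sqsum_nat _); apply: sqsum_sqr.
exists ('X^2 + m%:Z%:P).
  by rewrite monicE lead_coefDl ?lead_coefXn // size_polyXn size_polyC; case: eqP.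
by rewrite /root rmorphD /= map_polyXn map_polyC !hornerE /= Da addNr.
Qed.

Hypothesis sqsumN1 : sqsum (- 1).

Lemma sqsumN x : sqsum x -> sqsum (- x).
Proof. by rewrite -mulN1r; apply: sqsumM. Qed.

Lemma sqsum_intr k : sqsum k%:~R.
Proof.
case: k => i; first exact: sqsum_nat.
by rewrite NegzE mulrNz; apply/sqsumN/sqsum_nat.
Qed.

Lemma sqsum_double x : integer x -> sqsum (2 * x).
Proof.
move=> Ix; have -> : 2 * x = (x + 1) ^+ 2 + - (x ^+ 2) + -1 by ring.
apply: sqsumD sqsumN1; apply: sqsumD; last exact/sqsumN/sqsum_sqr.
by apply/sqsum_sqr/integral_add/integral1.
Qed.

Lemma sqsum_odd_mul k x :
  integer x -> sqsum ((4 * k + 1)%:~R * x) -> sqsum x.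
Proof.
move=> Ix Sx; have -> : x = (4 * k + 1)%:~R * x + - (2 * (2 * k%:~R * x)).
  by rewrite rmorphD rmorphM /=; ring.
apply: sqsumD Sx _; apply/sqsumN/sqsum_double.
by apply: integral_mul Ix; apply: integral_mul (integer_intr k); apply: integral_nat.
Qed.

Section QuadraticStep.

(* [t] plays the role of (1 + sqrt d)/2 for d = 4 k + 1; its conjugate is [1 - t]. *)
Variables (F : {subfield K}) (t : K) (k : int).
Hypothesis Dt : t ^+ 2 = t + k%:~R.

(** The reduction uses only [t ^+ 2 = t + k], an equation that [1 - t] satisfies as well, so the
    same [A] and [B] serve both values. *)
Lemma horner_quadratic (p : {poly K}) u v :
    p \is a polyOver F -> u \in F -> v \in F ->
  exists A B, [/\ A \in F, B \in F, p.[u + v * t] = A + B * t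
                & p.[u + v * (1 - t)] = A + B * (1 - t)].
Proof.
move=> + Fu Fv; elim/poly_ind: p => [|p c IHp] Fp.
  by exists 0, 0; rewrite !horner0 !mul0r addr0 !mem0v.
have Fpc i : (p * 'X + c%:P)`_i \in F by apply: (polyOverP Fp).
have Fc : c \in F by have := Fpc 0; rewrite coefD coefMX coefC /= add0r.
have [|A [B [FA FB DA DB]]] := IHp.
  by apply/polyOverP=> i; have := Fpc i.+1; rewrite coefD coefMX coefC /= addr0.
have Fk : k%:~R \in F by rewrite rpred_int.
(* These are the coefficients of [(A + B t) (u + v t) + c] after [t ^+ 2] is replaced by [t + k]. *)
exists (A * u + B * v * k%:~R + c), (A * v + B * u + B * v).
rewrite !rpredD ?rpredM // !hornerE DA DB; split=> //.
  transitivity (A * u + (A * v + B * u) * t + B * v * t ^+ 2 + c); first by ring.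
  by rewrite Dt; ring.
transitivity (A * u + (A * v + B * u) * (1 - t) + B * v * (1 - 2 * t + t ^+ 2) + c).
  by ring.
by rewrite Dt; ring.
Qed.

Lemma integer_quadratic_conj u v :
    t \notin F -> u \in F -> v \in F ->
  integer (u + v * t) -> integer (u + v * (1 - t)).
Proof.
move=> F't Fu Fv [p mon_p pz0]; exists p => //.
have Fp : map_poly intr p \is a polyOver F.
  by apply/polyOverP=> i; rewrite coef_map rpred_int.
have [A [B [FA FB DA DB]]] := horner_quadratic Fp Fu Fv.
move: pz0; rewrite /root DA DB; have [->|nzB] := eqVneq B 0; first by rewrite !mul0r.
rewrite addrC addr_eq0 => /eqP DBt; case/negP: F't.
by rewrite -[t](mulKf nzB) DBt rpredM ?rpredN ?rpredV.
Qed.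

Lemma integer_quadratic z :
    z \in <<F; t>>%VS -> integer z -> integer t ->
  exists u v, [/\ u \in F, v \in F, integer u, integer v
                & (4 * k + 1)%:~R * z = u + v * t].
Proof.
move=> Fz Iz It; pose d : K := (4 * k + 1)%:~R.
have Fd : d \in F by rewrite rpred_int.
have Id : integer d by apply: integer_intr.
(* If the extension is trivial, conjugation makes no sense, but the second coefficient can be taken
   to be 0. *)
have [Ft | F't] := boolP (t \in F).
  rewrite (Fadjoin_idP Ft) in Fz; exists (d * z), 0.
  rewrite mem0v rpredM // mul0r addr0; split=> //; first exact: integral_mul.
  exact: integral0.
have [p Fp Dz] := Fadjoin_polyP Fz.
have [] := horner_quadratic Fp (mem0v F) (mem1v F).
move=> u [v []]; rewrite add0r mul1r -Dz => Fu Fv Dzuv _.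
have Iz' : integer (u + v * (1 - t)).
  by apply: integer_quadratic_conj; rewrite -?Dzuv.
have Idv : integer (d * v).
  (* Subtracting the conjugate from [z] leaves [v (2 t - 1)], and [(2 t - 1) ^+ 2 = d]. *)
  have -> : d * v = (z - (u + v * (1 - t))) * (2 * t - 1).
    rewrite Dzuv; transitivity (v * (4 * t ^+ 2 - 4 * t + 1)); last by ring.
    by rewrite Dt /d rmorphD rmorphM /=; ring.
  apply: integral_mul; first exact: integral_sub.
  by apply: integral_sub; [apply: integral_mul It; apply: integral_nat | apply: integral1].
exists (d * u), (d * v); rewrite !rpredM //; split=> //; last by rewrite Dzuv /d; ring.
have -> : d * u = d * z - d * v * t by rewrite Dzuv; ring.
by apply: integral_sub; apply: integral_mul.
Qed.

Lemma sqsum_quadratic :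
    integer t -> (forall u, u \in F -> integer u -> sqsum u) ->
  forall z, z \in <<F; t>>%VS -> integer z -> sqsum z.
Proof.
move=> It SF z Fz Iz; apply: (sqsum_odd_mul (k := k)) => //.
have [u [v [Fu Fv Iu Iv ->]]] := integer_quadratic Fz Iz It.
apply: sqsumD (SF u Fu Iu) _; apply: sqsumM (SF v Fv Iv) _.
have -> : t = t ^+ 2 + - k%:~R by rewrite Dt addrK.
exact: sqsumD (sqsum_sqr It) (sqsumN (sqsum_intr k)).
Qed.

End QuadraticStep.

Lemma sqsum_rational z : z \in 1%VS -> integer z -> sqsum z.
Proof. by case/vlineP=> c -> /rational_integer[k ->]; apply: sqsum_intr. Qed.

(** The scalar is rational, so that cancelling 2 is a computation in [rat]. *)
Definition half_unit (b : K) : K := 2^-1 *: (1 + b).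

Lemma half_unitK b : b = 2 * half_unit b - 1.
Proof.
by rewrite /half_unit mulr_natl -scaler_nat scalerA divff // scale1r addrC addKr.
Qed.

Lemma half_unit_sqr b k :
  b ^+ 2 = (4 * k + 1)%:~R -> half_unit b ^+ 2 = half_unit b + k%:~R.
Proof.
move=> Db; rewrite {1}/half_unit exprZn.
have -> : (1 + b) ^+ 2 = 4 * (half_unit b + k%:~R).
  transitivity (1 + 2 * b + b ^+ 2); first by ring.
  by rewrite Db {1}(half_unitK b) rmorphD rmorphM /=; ring.
rewrite mulr_natl -scaler_nat scalerA.
by have -> : 2^-1 ^+ 2 * 4 = 1 :> rat; [ | rewrite scale1r].
Qed.

Lemma integer_quadratic_root t k : t ^+ 2 = t + k%:~R -> integer t.
Proof.
(* The bracket has degree at most 1, so the polynomial is monic. *)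
move=> Dt; exists ('X^2 - ('X + k%:P)).
  rewrite monicE lead_coefDl ?lead_coefXn // size_polyN size_polyXn ltnS.
  by rewrite (leq_trans (size_polyD _ _)) // geq_max size_polyX size_polyC; case: eqP.
by rewrite /root rmorphB rmorphD /= map_polyXn map_polyX map_polyC !hornerE /= Dt subrr.
Qed.

Lemma sqsum_biquadratic a b k l :
    a ^+ 2 = (4 * k + 1)%:~R -> b ^+ 2 = (4 * l + 1)%:~R ->
    <<1 & [:: a; b]>>%VS = fullv ->
  forall z, integer z -> sqsum z.
Proof.
move=> /half_unit_sqr Dw /half_unit_sqr Dt Kab z Iz.
set w := half_unit a in Dw; set t := half_unit b in Dt.
have Iw := integer_quadratic_root Dw; have It := integer_quadratic_root Dt.
pose F := <<1; w>>%AS.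
(* The quadratic step is applied twice, from [F] to [F(t)] and from the rationals to [F]; then
   [F(t)] must be shown to be all of [K]. *)
apply: (@sqsum_quadratic F t l Dt It) Iz => [|].
  by apply: (@sqsum_quadratic 1%AS w k Dw Iw); apply: sqsum_rational.
have Fw : w \in <<F; t>>%VS by rewrite (subvP (subv_adjoin _ _)) // memv_adjoin.
suffices /subvP : (<<1 & [:: a; b]>> <= <<F; t>>)%VS by apply; rewrite Kab memvf.
apply/Fadjoin_seqP; split=> [|x]; first exact: sub1v.
(* The generators are recovered as [a = 2 w - 1] and [b = 2 t - 1]. *)
have E_half c : half_unit c \in <<F; t>>%VS -> c \in <<F; t>>%VS.
  by move=> Ec; rewrite (half_unitK c) rpredB ?rpred1 // rpredM ?rpred_nat.
by rewrite !inE => /orP[]/eqP->; apply: E_half; last exact: memv_adjoin.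
Qed.

Lemma natr_mod4 (i r : nat) : (r < 4)%N -> i = r %[mod 4] ->
  i%:R = (4 * (i %/ 4)%:Z + r%:Z)%:~R :> K.
Proof.
move=> lt_r4 Dr; rewrite -[LHS]/(i%:Z%:~R); congr (_%:~R).
by rewrite {1}(divn_eq i 4) Dr modn_small // PoszD PoszM mulrC.
Qed.

End SumsOfSquares.

Theorem theorem1p1 (m n : nat) (K : fieldExtType rat)
    (m_gt0 : 0 < m) (n_gt0 : 0 < n)
    (m_mod4 : m = 3 %[mod 4]) (n_mod4 : n = 1 %[mod 4])
    (m_sqfree : squarefree m) (n_sqfree : squarefree n)
    (m_neq_n : m <> n)
    (K_gen : is_adjunction_of_sqrts m n K) :
  forall z : K, sums_of_squares z <-> ring_of_integers z.
Proof.
have [a [b [Da Db Kab]]] := K_gen.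
move=> z; split=> [[]// | ]; move: z.
(* With [m = 4 q + 3], one has [- m = 4 (- (q + 1)) + 1], so both radicands have the form
   [4 k + 1]. *)
apply: (@sqsum_biquadratic K _ a b (- ((m %/ 4)%:Z + 1))%R (n %/ 4)%:Z _ _ Kab).
- exact: sqsumN1_sqrtN m_gt0 Da.
- by rewrite Da (natr_mod4 _ _ m_mod4) // -GRing.rmorphN; congr (_%:~R)%R; ring.
- by rewrite Db (natr_mod4 _ _ n_mod4).
Qed.
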